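(* Let $1\le n\le N$. For every $x$ at which $\mathscr C_{1,n}(x)$ and $\mathscr D_{1,n}(x)$ are defined, $\mathscr D_{1,n}(x)\neq0$, and $f_n(x)-1\notin\{0,-1,\dots,-(n-1)\}$, where $$f_n(x)=\frac{np(N-n+1)\,\mathscr C_{1,n}(x)}{\mathscr D_{1,n}(x)}-n+1,$$ one has $$\mathbb K_n(x)=p^{n-1}(-N)_{n-1}\,h_n(x)\sum_{k=0}^{n}\frac{(-n)_k(-x)_k\,(f_n(x))_k}{(-N)_k\,(f_n(x)-1)_k}\frac{p^{-k}}{k!},\qquad h_n(x)=-\big(p(N-n+1)\,\mathscr C_{1,n}(x)-\mathscr D_{1,n}(x)\big),$$ i.e. $\mathbb K_n(x)=p^{n-1}(-N)_{n-1}h_n(x)\,{}_3F_2\!\left(-n,-x,f_n(x);-N,f_n(x)-1;p^{-1}\right)$ (terminating series).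
   Context: Fix an integer $N\ge 1$ and $0<p<1$. Notation: $(a)_0=1$, $(a)_k=a(a+1)\cdots(a+k-1)$ (Pochhammer symbol); $[z]_0=1$, $[z]_k=z(z-1)\cdots(z-k+1)$ (falling factorial). For a function $f$, $\Delta f(x)=f(x+1)-f(x)$, $\nabla f(x)=f(x)-f(x-1)$, $\Delta^0$ is the identity and $\Delta^k=\Delta\circ\Delta^{k-1}$. For $0\le n\le N$ the monic Kravchuk polynomial is $K_n(x)=p^n(-N)_n\sum_{k=0}^{n}\frac{(-n)_k(-x)_k}{(-N)_k\,k!}p^{-k}$, and $K_{-1}=0$; these are monic of degree $n$ and orthogonal on $\{0,\dots,N\}$ with respect to the binomial weight $w(x)=\binom{N}{x}p^x(1-p)^{N-x}$, with $\|K_n\|^2=\sum_{x=0}^N K_n(x)^2w(x)=n!(-N)_np^n(p-1)^n$. For $1\le n\le N+1$ and integers $i,l\ge0$, $\mathscr K_{n-1}^{(i,l)}(x,y)=\sum_{k=0}^{n-1}\frac{\Delta^iK_k(x)\,\Delta^lK_k(y)}{\|K_k\|^2}$. Fix $\lambda,\mu>0$ and an integer $j\ge 0$. On real polynomials define $\langle f,g\rangle_{\lambda,\mu}=\sum_{x=0}^N f(x)g(x)w(x)+\lambda\Delta^jf(0)\Delta^jg(0)+\mu\Delta^jf(N)\Delta^jg(N)$. For $0\le n\le N$, $\mathbb K_n=\mathbb K_n^{(j)}$ is the monic polynomial of degree $n$ with $\langle\mathbb K_n,q\rangle_{\lambda,\mu}=0$ for all polynomials $q$ of degree $<n$ (Kravchuk–Sobolev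 polynomials). For $1\le n\le N$: $\mathscr A_n(x,y)=\frac{j!}{\|K_{n-1}\|^2[x-y]_{j+1}}\sum_{k=0}^{j}\frac{\Delta^kK_{n-1}(y)}{k!}[x-y]_k$, $\mathscr B_n(x,y)=-\frac{j!}{\|K_{n-1}\|^2[x-y]_{j+1}}\sum_{k=0}^{j}\frac{\Delta^kK_{n}(y)}{k!}[x-y]_k$; $k_{00}=\mathscr K^{(j,j)}_{n-1}(0,0)$, $k_{0N}=\mathscr K^{(j,j)}_{n-1}(0,N)$, $k_{N0}=\mathscr K^{(j,j)}_{n-1}(N,0)$, $k_{NN}=\mathscr K^{(j,j)}_{n-1}(N,N)$, $d_0=\Delta^jK_n(0)$, $d_N=\Delta^jK_n(N)$, $\delta_n=(1+\lambda k_{00})(1+\mu k_{NN})-\lambda\mu k_{0N}k_{N0}$ (which is nonzero), $\Phi_1(n)=\frac{d_0(1+\mu k_{NN})-\mu k_{0N}d_N}{\delta_n}$, $\Phi_2(n)=\frac{(1+\lambda k_{00})d_N-\lambda k_{N0}d_0}{\delta_n}$; $\mathscr C_{1,n}(x)=1-\lambda\Phi_1(n)\mathscr A_n(x,0)-\mu\Phi_2(n)\mathscr A_n(x,N)$ and $\mathscr D_{1,n}(x)=-\lambda\Phi_1(n)\mathscr B_n(x,0)-\mu\Phi_2(n)\mathscr B_n(x,N)$. *)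

(* Defs.v *)
From mathcomp Require Import all_boot all_order all_algebra.
Set Implicit Arguments. Unset Strict Implicit. Unset Printing Implicit Defensive.
Import Order.TTheory GRing.Theory Num.Theory.
Local Open Scope ring_scope.

Section KS.
Variable R : realFieldType.

Definition poch (a : R) (k : nat) : R := \prod_(i < k) (a + i%:R).
Definition ffact (z : R) (k : nat) : R := \prod_(i < k) (z - i%:R).
Definition fdiff (f : R -> R) : R -> R := fun x => f (x + 1) - f x.
Definition fdiffn (k : nat) (f : R -> R) : R -> R := iter k fdiff f.

Definition wbin (N : nat) (p : R) (x : nat) : R :=
  'C(N, x)%:R * p ^+ x * (1 - p) ^+ (N - x).

(* monic Kravchuk polynomial K_n (as a function of real x), 0 <= n <= N *)
Definition Kraw (N : nat) (p : R) (n : nat) (x : R) : R :=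
  p ^+ n * poch (- N%:R) n *
  \sum_(k < n.+1) (poch (- n%:R) k * poch (- x) k / (poch (- N%:R) k * k`!%:R))
                    * p ^- k.

Definition knorm2 (N : nat) (p : R) (n : nat) : R :=
  \sum_(x < N.+1) Kraw N p n x%:R ^+ 2 * wbin N p x.

(* kernel  \mathscr K^{(i,l)}_{n-1}(x,y) = sum_{k=0}^{n-1} ... *)
Definition kern (N : nat) (p : R) (n i l : nat) (x y : R) : R :=
  \sum_(k < n) fdiffn i (Kraw N p k) x * fdiffn l (Kraw N p k) y / knorm2 N p k.

Definition sobip (N : nat) (p lam mu : R) (j : nat) (f g : {poly R}) : R :=
  \sum_(x < N.+1) f.[x%:R] * g.[x%:R] * wbin N p x
  + lam * fdiffn j (horner f) 0 * fdiffn j (horner g) 0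
  + mu * fdiffn j (horner f) N%:R * fdiffn j (horner g) N%:R.

Definition scrA (N : nat) (p : R) (j n : nat) (x y : R) : R :=
  j`!%:R / (knorm2 N p n.-1 * ffact (x - y) j.+1) *
  \sum_(k < j.+1) fdiffn k (Kraw N p n.-1) y / k`!%:R * ffact (x - y) k.

Definition scrB (N : nat) (p : R) (j n : nat) (x y : R) : R :=
  - (j`!%:R / (knorm2 N p n.-1 * ffact (x - y) j.+1)) *
  \sum_(k < j.+1) fdiffn k (Kraw N p n) y / k`!%:R * ffact (x - y) k.

Definition k00 N p j n := kern N p n j j 0 0.
Definition k0N N p j n := kern N p n j j 0 N%:R.
Definition kN0 N p j n := kern N p n j j N%:R 0.
Definition kNN N p j n := kern N p n j j N%:R N%:R.
Definition d0 N p j n := fdiffn j (Kraw N p n) 0.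
Definition dN N p j n := fdiffn j (Kraw N p n) N%:R.

Definition deltan N p (lam mu : R) j n : R :=
  (1 + lam * k00 N p j n) * (1 + mu * kNN N p j n) - lam * mu * k0N N p j n * kN0 N p j n.

Definition Phi1 N p (lam mu : R) j n : R :=
  (d0 N p j n * (1 + mu * kNN N p j n) - mu * k0N N p j n * dN N p j n)
  / deltan N p lam mu j n.

Definition Phi2 N p (lam mu : R) j n : R :=
  ((1 + lam * k00 N p j n) * dN N p j n - lam * kN0 N p j n * d0 N p j n)
  / deltan N p lam mu j n.

Definition C1 N p (lam mu : R) j n (x : R) : R :=
  1 - lam * Phi1 N p lam mu j n * scrA N p j n x 0
    - mu * Phi2 N p lam mu j n * scrA N p j n x N%:R.

Definition D1 N p (lam mu : R) j n (x : R) : R :=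
  - lam * Phi1 N p lam mu j n * scrB N p j n x 0
  - mu * Phi2 N p lam mu j n * scrB N p j n x N%:R.

Definition fn N p (lam mu : R) j n (x : R) : R :=
  n%:R * p * (N%:R - n%:R + 1) * C1 N p lam mu j n x / D1 N p lam mu j n x
  - n%:R + 1.

Definition hn N p (lam mu : R) j n (x : R) : R :=
  - (p * (N%:R - n%:R + 1) * C1 N p lam mu j n x - D1 N p lam mu j n x).

End KS.

(* Main.v *)
(** For weights on a finite grid, every linear functional on polynomials of degree
    less than [n] is represented by its Riesz polynomial with respect to the monic
    orthogonal family; representers of evaluations are the Christoffel-Darboux
    kernels. The Sobolev polynomial therefore equals [K_n] minus multiples of the
    representers of [f |-> Delta^j f(0)] and [f |-> Delta^j f(N)], and the two
    coefficients solve a 2x2 system whose determinant is positive because the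
    kernels form a Gram matrix. A discrete Leibniz rule applied to the
    Christoffel-Darboux formula expresses both representers through [K_n] and
    [K_(n-1)], so the polynomial is [C1 * K_n + D1 * K_(n-1)]. Since
    [(f)_k / (f - 1)_k = 1 + k / (f - 1)], the terminating 3F2 series splits into
    the same combination, term by term. *)

From HB Require Import structures.
Require Import Defs.
From mathcomp Require Import all_boot all_order all_algebra ring.
Import Order.TTheory GRing.Theory Num.Theory.
Local Open Scope ring_scope.
Set Implicit Arguments.
Unset Strict Implicit.

Lemma ffactnD (n k m : nat) : (n ^_ (k + m) = n ^_ k * (n - k) ^_ m)%N.
Proof.
elim: m => [|m IHm]; first by rewrite addn0 muln1.
by rewrite addnS !ffactnSr IHm mulnA subnDA.
Qed.

Section PolynomialCoefficients.
Variable R : nzRingType.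
Implicit Types f g q : {poly R}.

Lemma size_sub_coef (n : nat) f g :
  (size f <= n.+1)%N -> (size g <= n.+1)%N -> f`_n = g`_n ->
  (size (f - g)%R <= n)%N.
Proof.
move=> size_f size_g eq_coef; apply/leq_sizeP => i; rewrite coefB.
rewrite leq_eqVlt => /predU1P[<-|lt_ni]; first by rewrite eq_coef subrr.
by rewrite !nth_default ?subrr // (leq_trans _ lt_ni).
Qed.

Lemma monic_coef (n : nat) f : f \is monic -> size f = n.+1 -> f`_n = 1.
Proof. by move=> /monicP; rewrite lead_coefE => + size_f; rewrite size_f. Qed.

Lemma size_lincomb_leq (I : finType) (m : nat) (a : I -> R) (g : I -> {poly R}) :
  (forall i, size (g i) <= m)%N -> (size (\sum_i a i *: g i)%R <= m)%N.
Proof.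
move=> size_g; apply: leq_trans (size_sum _ _ _) _; apply/bigmax_leqP => i _.
exact: leq_trans (size_scale_leq _ _) (size_g i).
Qed.

Lemma size_mulXsubC_leq (n : nat) (y : R) q :
  (size q <= n)%N -> (size (('X - y%:P) * q)%R <= n.+1)%N.
Proof.
by move=> size_q; rewrite (leq_trans (size_polyMleq _ _)) // size_XsubC.
Qed.

Lemma coef_mulXsubC (n : nat) (y : R) q :
  (size q <= n.+1)%N -> (('X - y%:P) * q)`_n.+1 = q`_n.
Proof.
move=> size_q; rewrite mulrBl coefB coefXM coefCM /=.
by rewrite (nth_default _ size_q) mulr0 subr0.
Qed.

End PolynomialCoefficients.

Lemma scalar_graded_eq0 (R : fieldType) (L : {scalar {poly R}})
    (g : nat -> {poly R}) (n : nat) :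
  (forall k, (k < n)%N -> size (g k) = k.+1) ->
  (forall k, (k < n)%N -> L (g k) = 0) ->
  forall q : {poly R}, (size q <= n)%N -> L q = 0.
Proof.
elim: n => [|n IHn] size_g Lg q size_q.
  by move: size_q; rewrite size_poly_leq0 => /eqP->; rewrite linear0.
have size_gn := size_g n (ltnSn n).
have coef_neq0 : (g n)`_n != 0.
  have := lead_coef_eq0 (g n).
  by rewrite lead_coefE -size_poly_eq0 size_gn /= => ->.
rewrite -(subrK ((q`_n / (g n)`_n) *: g n) q) linearD scalarZ Lg // mulr0 addr0.
apply: IHn => [k /ltnW/size_g|k /ltnW/Lg|] //.
apply: size_sub_coef => //; last by rewrite coefZ divfK.
by rewrite (leq_trans (size_scale_leq _ _)) ?size_gn.
Qed.

Section PolynomialDifference.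
Variable R : idomainType.
Implicit Types q : {poly R}.

Lemma size_sub_comp_XaddC (n : nat) (c : R) q :
  (size q <= n.+1)%N -> (size (q - (q \Po ('X + c%:P)))%R <= n)%N.
Proof.
move=> size_q.
have size_XaddC2 : size ('X + c%:P : {poly R}) = 2%N by rewrite size_XaddC.
have size_comp := size_comp_poly2 q size_XaddC2.
apply: size_sub_coef; rewrite ?size_comp //.
have [size_qn|ne_qn] := eqVneq (size q) n.+1; last first.
  by rewrite !nth_default ?size_comp // -ltnS ltn_neqAle ne_qn.
have := @lead_coef_comp _ q ('X + c%:P).
rewrite !lead_coefE size_comp size_XaddC2 size_qn /=.
by rewrite coefD coefX coefC addr0 expr1n mulr1 => ->.
Qed.

(* Pascal's rule turns the sum for [n.+1] and [q] into the sum for [n] and the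
   difference [q(X) - q(X + 1)], which has smaller degree. *)
Lemma sum_sign_bin_horner_eq0 (n : nat) q : (size q <= n)%N ->
  \sum_(k < n.+1) (-1) ^+ k * 'C(n, k)%:R * q.[k%:R] = 0.
Proof.
elim: n q => [|n IHn] q size_q.
  move: size_q; rewrite size_poly_leq0 => /eqP->.
  by rewrite big_ord1 horner0 mulr0.
rewrite -[RHS](IHn (q - (q \Po ('X + 1%:P)))) ?size_sub_comp_XaddC //.
under [RHS]eq_bigr do rewrite hornerD hornerN horner_comp !hornerE mulrBr natr1.
rewrite sumrB big_ord_recl /= bin0.
under eq_bigr => k _ do
  rewrite /bump add1n binS natrD exprS mulrDr mulrDl mulN1r !mulNr.
rewrite big_split /= !sumrN addrA; congr (_ - _).
rewrite [in LHS]big_ord_recr [in RHS]big_ord_recl /= bin0 bin_small //.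
rewrite mulr0 mul0r addr0 -sumrN; congr (_ + _).
by apply: eq_bigr => k _; rewrite /bump add1n exprS; ring.
Qed.

End PolynomialDifference.

Section DiscreteInnerProduct.
Variables (R : realFieldType) (I : finType) (t w : I -> R).
Implicit Types f g q : {poly R}.

Definition dotp f g : R := \sum_i f.[t i] * g.[t i] * w i.

Lemma dotpC f g : dotp f g = dotp g f.
Proof. by apply: eq_bigr => i _; rewrite (mulrC f.[_]). Qed.

Lemma dotp_mul_adj q f g : dotp (q * f) g = dotp f (q * g).
Proof. by apply: eq_bigr => i _; rewrite !hornerM (mulrC q.[_]) !mulrA. Qed.

Fact dotp_is_scalar f : scalar (dotp f).
Proof.
move=> a g h; rewrite /dotp mulr_sumr -big_split /=; apply: eq_bigr => i _.
by rewrite hornerD hornerZ; ring.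
Qed.

HB.instance Definition _ f :=
  GRing.isLinear.Build R {poly R} R _ (dotp f) (dotp_is_scalar f).

Lemma dotpBl f g h : dotp (f - g) h = dotp f h - dotp g h.
Proof. by rewrite dotpC linearB /= !(dotpC h). Qed.

Lemma dotpZl a f g : dotp (a *: f) g = a * dotp f g.
Proof. by rewrite dotpC scalarZ /= dotpC. Qed.

Definition monic_orthogonal (m : nat) (Q : nat -> {poly R}) : Prop :=
  forall n, (n < m)%N ->
    [/\ Q n \is monic, size (Q n) = n.+1
      & forall q, (size q <= n)%N -> dotp (Q n) q = 0].

Definition riesz (Q : nat -> {poly R}) (n : nat) (L : {poly R} -> R) : {poly R} :=
  \sum_(k < n) (L (Q k) / dotp (Q k) (Q k)) *: Q k.

Lemma scalar_riesz Q n (L M : {scalar {poly R}}) :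
  L (riesz Q n M) = \sum_(k < n) L (Q k) * M (Q k) / dotp (Q k) (Q k).
Proof.
by rewrite linear_sum; apply: eq_bigr => k _; rewrite scalarZ mulrC mulrA.
Qed.

Lemma scalar_rieszC Q n (L M : {scalar {poly R}}) :
  L (riesz Q n M) = M (riesz Q n L).
Proof.
by rewrite !scalar_riesz; apply: eq_bigr => k _; rewrite (mulrC (L _)).
Qed.

Hypothesis w_gt0 : forall i, 0 < w i.

Lemma dotp_ge0 f : 0 <= dotp f f.
Proof. by apply: sumr_ge0 => i _; rewrite -expr2 mulr_ge0 ?sqr_ge0 ?ltW. Qed.

Lemma gram_det_gt0 (a b : R) f g : 0 <= a -> 0 <= b ->
  0 < (1 + a * dotp f f) * (1 + b * dotp g g) - a * b * dotp f g * dotp g f.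
Proof.
move=> a_ge0 b_ge0; set c := 1 + a * dotp f f.
have c_gt0 : 0 < c by rewrite ltr_pwDl // mulr_ge0 ?dotp_ge0.
have minor_ge0 : 0 <= c * dotp g g - a * dotp f g ^+ 2.
  rewrite -(pmulr_rge0 _ c_gt0) [leRHS](_ : _ =
    dotp (c *: g - (a * dotp f g) *: f) (c *: g - (a * dotp f g) *: f)
      + a * dotp f g ^+ 2).
    by rewrite addr_ge0 ?dotp_ge0 // mulr_ge0 ?sqr_ge0.
  by rewrite linearB !scalarZ /= !dotpBl !dotpZl (dotpC g f) /c; ring.
rewrite (dotpC g f) [ltRHS](_ : _ =
  c + b * (c * dotp g g - a * dotp f g ^+ 2)); last by ring.
by rewrite ltr_pwDl // mulr_ge0.
Qed.

Hypothesis t_inj : injective t.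

Lemma dotp_gt0 f : f != 0 -> (size f <= #|I|)%N -> 0 < dotp f f.
Proof.
move=> f_neq0 size_f; rewrite lt_def dotp_ge0 andbT.
have term_ge0 i : true -> 0 <= f.[t i] * f.[t i] * w i.
  by rewrite -expr2 mulr_ge0 ?sqr_ge0 ?ltW.
apply: contra_neq f_neq0 => /(psumr_eq0P term_ge0) f_vanish.
apply: (@roots_geq_poly_eq0 _ _ (codom t)); rewrite ?size_codom //; last first.
  by rewrite map_inj_uniq ?enum_uniq.
apply/allP => _ /codomP[i ->]; have /eqP := f_vanish i isT.
by rewrite !mulf_eq0 (gt_eqF (w_gt0 i)) orbF orbb.
Qed.

Lemma dotp_nondegenerate n f : (n <= #|I|)%N -> (size f <= n)%N ->
  (forall q, (size q <= n)%N -> dotp f q = 0) -> f = 0.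
Proof.
move=> le_nI size_f /(_ f size_f) dotp_ff; apply: contra_eq dotp_ff => f_neq0.
by rewrite gt_eqF // dotp_gt0 // (leq_trans size_f).
Qed.

Section MonicOrthogonal.
Variables (m : nat) (Q : nat -> {poly R}).
Hypotheses (le_mI : (m <= #|I|)%N) (orthoQ : monic_orthogonal m Q).
Implicit Types L M : {scalar {poly R}}.

Lemma orthogonal_norm_neq0 n : (n < m)%N -> dotp (Q n) (Q n) != 0.
Proof.
move=> lt_nm; have [monic_Q size_Q _] := orthoQ lt_nm.
by rewrite gt_eqF // dotp_gt0 ?monic_neq0 // size_Q (leq_trans lt_nm).
Qed.

Lemma orthogonal_dot_coef n q : (n < m)%N -> (size q <= n.+1)%N ->
  dotp (Q n) q = q`_n * dotp (Q n) (Q n).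
Proof.
move=> lt_nm size_q; have [monic_Q size_Q ortho] := orthoQ lt_nm.
rewrite -scalarZ -{1}(subrK (q`_n *: Q n) q) linearD /= ortho ?add0r //.
apply: size_sub_coef => //; last by rewrite coefZ (monic_coef monic_Q) ?mulr1.
by rewrite (leq_trans (size_scale_leq _ _)) ?size_Q.
Qed.

Lemma size_riesz n L : (n <= m)%N -> (size (riesz Q n L) <= n)%N.
Proof.
move=> le_nm; apply: size_lincomb_leq => k.
by have [_ -> _] := orthoQ (leq_trans (ltn_ord k) le_nm).
Qed.

Lemma dotp_orthogonal_neq k l : (k < m)%N -> (l < m)%N -> k != l ->
  dotp (Q k) (Q l) = 0.
Proof.
move=> lt_km lt_lm.
have [[_ size_k ortho_k] [_ size_l ortho_l]] := (orthoQ lt_km, orthoQ lt_lm).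
rewrite neq_ltn => /orP[lt_kl|lt_lk]; last by rewrite ortho_k ?size_l.
by rewrite dotpC ortho_l ?size_k.
Qed.

Lemma dotp_riesz n L q :
  (n <= m)%N -> (size q <= n)%N -> dotp (riesz Q n L) q = L q.
Proof.
move=> le_nm size_q; apply/eqP; rewrite -subr_eq0; apply/eqP.
apply: (scalar_graded_eq0 (L := dotp (riesz Q n L) \- L) (g := Q)) size_q.
  by move=> k lt_kn; have [] := orthoQ (leq_trans lt_kn le_nm).
move=> k lt_kn; have lt_km := leq_trans lt_kn le_nm.
rewrite /= dotpC scalar_riesz (bigD1 (Ordinal lt_kn)) //= big1 => [|l ne_lk].
  by rewrite addr0 mulrAC divff ?mul1r ?subrr ?orthogonal_norm_neq0.
by rewrite dotp_orthogonal_neq ?mul0r // 1?eq_sym // (leq_trans _ le_nm).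
Qed.

Lemma coef_riesz n L : (n < m)%N ->
  (riesz Q n.+1 L)`_n = L (Q n) / dotp (Q n) (Q n).
Proof.
move=> lt_nm; apply/(canRL (mulfK (orthogonal_norm_neq0 lt_nm))).
rewrite -orthogonal_dot_coef ?size_riesz // dotpC dotp_riesz //.
by have [_ -> _] := orthoQ lt_nm.
Qed.

Lemma dotp_riesz_eval_mulXsubC n y q : (n.+1 < m)%N -> (size q <= n.+1)%N ->
  dotp (riesz Q n.+1 (horner_eval y)) (('X - y%:P) * q) = - q`_n * (Q n.+1).[y].
Proof.
move=> lt_nm size_q; have [monic_QS size_QS orthoS] := orthoQ lt_nm.
rewrite -[_ * q](subrK (q`_n *: Q n.+1)) linearD scalarZ /=.
rewrite [X in q`_n * X]dotpC orthoS ?size_riesz ?(ltnW lt_nm) // mulr0 addr0.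
rewrite dotp_riesz ?(ltnW lt_nm) //.
  rewrite /= /horner_eval hornerD hornerN hornerZ hornerM hornerXsubC.
  by rewrite subrr mul0r sub0r mulNr.
apply: size_sub_coef; first exact: size_mulXsubC_leq.
  by rewrite (leq_trans (size_scale_leq _ _)) ?size_QS.
by rewrite coef_mulXsubC // coefZ (monic_coef monic_QS) ?mulr1.
Qed.

(* Both sides have degree at most [n] and the same inner product with every [q] of
   degree at most [n], namely [- q`_n * (Q n.+1).[y]]. *)
Lemma christoffel_darboux n y : (n.+1 < m)%N ->
  ('X - y%:P) * riesz Q n.+1 (horner_eval y) =
  (dotp (Q n) (Q n))^-1 *: ((Q n).[y] *: Q n.+1 - (Q n.+1).[y] *: Q n).
Proof.
move=> lt_Snm; have lt_nm := ltnW lt_Snm.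
have [_ size_Qn _] := orthoQ lt_nm.
have [monic_QS size_QS orthoS] := orthoQ lt_Snm.
apply/eqP; rewrite -subr_eq0; apply/eqP/(@dotp_nondegenerate n.+1).
- exact: leq_trans lt_nm le_mI.
- apply: size_sub_coef; first by rewrite size_mulXsubC_leq ?size_riesz.
    rewrite (leq_trans (size_scale_leq _ _)) // (leq_trans (size_polyD _ _)) //.
    rewrite geq_max size_polyN.
    by rewrite !(leq_trans (size_scale_leq _ _)) ?size_Qn ?size_QS.
  rewrite coef_mulXsubC ?size_riesz // coef_riesz // coefZ coefB !coefZ.
  rewrite (monic_coef monic_QS) // [(Q n)`_n.+1]nth_default ?size_Qn //.
  by rewrite mulr0 subr0 mulr1 mulrC.
move=> q size_q; rewrite dotpBl dotp_mul_adj dotp_riesz_eval_mulXsubC //.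
rewrite dotpZl dotpBl !dotpZl orthoS // (orthogonal_dot_coef _ size_q) //.
by field; apply: orthogonal_norm_neq0.
Qed.

Section TwoFunctionalSobolev.
Variables (a b : R) (L M : {scalar {poly R}}) (n : nat) (P : {poly R}).
Hypotheses (a_ge0 : 0 <= a) (b_ge0 : 0 <= b) (lt_nm : (n < m)%N).
Hypotheses (monicP : P \is monic) (sizeP : size P = n.+1).
Hypothesis orthoP : forall q, (size q <= n)%N ->
  dotp P q + a * L P * L q + b * M P * M q = 0.

Let le_nm : (n <= m)%N := ltnW lt_nm.

Lemma sobolev_expansion :
  P = Q n - (a * L P) *: riesz Q n L - (b * M P) *: riesz Q n M.
Proof.
have [monic_Q size_Q orthoQn] := orthoQ lt_nm.
apply/eqP; rewrite -subr_eq0; apply/eqP/(@dotp_nondegenerate n).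
- exact: leq_trans le_nm le_mI.
- rewrite !opprD !opprK !addrA.
  do 2!rewrite (leq_trans (size_polyD _ _)) // geq_max
    [X in _ && X](leq_trans (size_scale_leq _ _)) ?size_riesz // andbT.
  apply: size_sub_coef; rewrite ?sizeP ?size_Q //.
  by rewrite (monic_coef monicP) // (monic_coef monic_Q).
move=> q size_q; rewrite !dotpBl !dotpZl orthoQn // !dotp_riesz //.
by rewrite sub0r !opprD !opprK addrA orthoP.
Qed.

Let k_LL := L (riesz Q n L).
Let k_LM := L (riesz Q n M).
Let k_ML := M (riesz Q n L).
Let k_MM := M (riesz Q n M).
Let delta := (1 + a * k_LL) * (1 + b * k_MM) - a * b * k_LM * k_ML.

Lemma sobolev_det_gt0 : 0 < delta.
Proof.
have gramE (S T : {scalar {poly R}}) :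
    S (riesz Q n T) = dotp (riesz Q n S) (riesz Q n T).
  by rewrite dotp_riesz ?size_riesz.
rewrite /delta /k_LL /k_LM /k_ML /k_MM.
rewrite (gramE L L) (gramE L M) (gramE M L) (gramE M M).
exact: gram_det_gt0.
Qed.

(* Applying [L] and [M] to the expansion gives a linear system with determinant
   [delta] for [L P] and [M P]; Cramer's rule solves it. *)
Lemma sobolev_functionals :
  L P = (L (Q n) * (1 + b * k_MM) - b * k_LM * M (Q n)) / delta /\
  M P = ((1 + a * k_LL) * M (Q n) - a * k_ML * L (Q n)) / delta.
Proof.
have delta_neq0 := lt0r_neq0 sobolev_det_gt0.
have eq_L : L (Q n) = L P + a * L P * k_LL + b * M P * k_LM.
  by rewrite {1}sobolev_expansion !linearB !scalarZ /k_LL /k_LM /=; ring.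
have eq_M : M (Q n) = M P + a * L P * k_ML + b * M P * k_MM.
  by rewrite {1}sobolev_expansion !linearB !scalarZ /k_ML /k_MM /=; ring.
rewrite eq_L eq_M.
by split; apply/(canRL (mulfK delta_neq0)); rewrite /delta; ring.
Qed.

End TwoFunctionalSobolev.
End MonicOrthogonal.
End DiscreteInnerProduct.

Section Factorials.
Variable R : realFieldType.
Implicit Types (x z a : R) (n k m : nat).

Lemma natr_fact_neq0 k : k`!%:R != 0 :> R.
Proof. by rewrite pnatr_eq0 -lt0n fact_gt0. Qed.

Lemma natr_ffact_neq0 n k : (k <= n)%N -> (n ^_ k)%:R != 0 :> R.
Proof. by move=> le_kn; rewrite pnatr_eq0 -lt0n ffact_gt0. Qed.


Lemma pochS a k : poch a k.+1 = poch a k * (a + k%:R).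
Proof. by rewrite /poch big_ord_recr. Qed.

Lemma poch_recl a k : poch a k.+1 = a * poch (a + 1) k.
Proof.
rewrite /poch big_ord_recl addr0; congr (_ * _).
by apply: eq_bigr => i _; rewrite /bump /= natrD addrA.
Qed.

Lemma poch_neq0 a k : (forall i, (i < k)%N -> a != - i%:R) -> poch a k != 0.
Proof. by move=> a_neq; apply/prodf_neq0 => i _; rewrite addr_eq0 a_neq. Qed.

Lemma poch_ratio a k : a != 0 -> poch a k != 0 ->
  poch (a + 1) k / poch a k = 1 + k%:R / a.
Proof.
move=> a_neq0 poch_a_neq0; apply/(canLR (mulfK poch_a_neq0))/(mulfI a_neq0).
by rewrite -poch_recl pochS; field.
Qed.

Lemma ffactS z k : ffact z k.+1 = ffact z k * (z - k%:R).
Proof. by rewrite /ffact big_ord_recr. Qed.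

Lemma poch_opp z k : poch (- z) k = (-1) ^+ k * ffact z k.
Proof.
elim: k => [|k IHk]; first by rewrite /poch /ffact !big_ord0 mul1r.
by rewrite pochS ffactS IHk exprS; ring.
Qed.

Lemma ffact_nat n k : ffact (n%:R : R) k = (n ^_ k)%:R.
Proof.
elim: k => [|k IHk]; first by rewrite /ffact big_ord0.
rewrite ffactS IHk ffactnSr natrM.
have [le_kn|lt_nk] := leqP k n; first by rewrite natrB.
by rewrite ffact_small // !mul0r.
Qed.

Definition ffact_poly k : {poly R} := \prod_(i < k) ('X - i%:R%:P).

Lemma horner_ffact_poly k x : (ffact_poly k).[x] = ffact x k.
Proof. by rewrite horner_prod; apply: eq_bigr => i _; rewrite hornerXsubC. Qed.

Lemma size_ffact_poly k : size (ffact_poly k) = k.+1.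
Proof. by rewrite size_prod_XsubC /index_enum -enumT size_enum_ord. Qed.

Definition coffact_poly N m : {poly R} := ffact_poly m \Po (N%:R%:P - 'X).

Lemma size_coffact_poly N m : size (coffact_poly N m) = m.+1.
Proof.
by rewrite size_comp_poly2 ?size_ffact_poly // -opprB size_polyN size_XsubC.
Qed.

Lemma horner_coffact_poly N m i :
  (i <= N)%N -> (coffact_poly N m).[i%:R] = ((N - i) ^_ m)%:R.
Proof.
move=> le_iN; rewrite horner_comp horner_ffact_poly !hornerE -natrB //.
exact: ffact_nat.
Qed.

End Factorials.

Local Arguments fdiffn {R} k f x : simpl never.

Section FiniteDifferences.
Variable R : realFieldType.
Implicit Types (f g : R -> R) (x y z a b : R).

Lemma eq_fdiffn k f g : f =1 g -> fdiffn k f =1 fdiffn k g.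
Proof.
move=> eq_fg; elim: k => [|k IHk] x; first exact: eq_fg.
by rewrite /fdiffn /= -!/(fdiffn k _) /fdiff !IHk.
Qed.

Lemma fdiffnS k f x : fdiffn k.+1 f x = fdiffn k f (x + 1) - fdiffn k f x.
Proof. by []. Qed.

Lemma fdiffn_lincomb k a b f g x :
  fdiffn k (fun y => a * f y + b * g y) x = a * fdiffn k f x + b * fdiffn k g x.
Proof.
elim: k x => [|k IHk] x //.
by rewrite !fdiffnS !IHk; ring.
Qed.

Definition fdiff_at k x (q : {poly R}) : R := fdiffn k (horner q) x.

Fact fdiff_at_is_scalar k x : scalar (fdiff_at k x).
Proof.
move=> a q r; rewrite /fdiff_at -[fdiffn k (horner r) x]mul1r -fdiffn_lincomb.
by apply: eq_fdiffn => y; rewrite hornerD hornerZ mul1r.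
Qed.

HB.instance Definition _ k x :=
  GRing.isLinear.Build R {poly R} R _ (fdiff_at k x) (fdiff_at_is_scalar k x).

(* Newton's forward-difference expansion of [f] about [y], evaluated at [y + z]. *)
Definition newton_sum j f y z : R :=
  \sum_(k < j.+1) fdiffn k f y / k`!%:R * ffact z k.

Lemma newton_sum_lincomb j a b f g y z :
  newton_sum j (fun x => a * f x + b * g x) y z =
    a * newton_sum j f y z + b * newton_sum j g y z.
Proof.
rewrite /newton_sum !mulr_sumr -big_split; apply: eq_bigr => k _ /=.
by rewrite fdiffn_lincomb; ring.
Qed.

Section Quotient.
Variables (x : R) (f g : R -> R).
Hypothesis fE : forall y, (x - y) * g y = f y.

Lemma fdiffnS_subM k y :
  fdiffn k.+1 f y = (x - y - k.+1%:R) * fdiffn k.+1 g y - k.+1%:R * fdiffn k g y.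
Proof.
elim: k y => [|k IHk] y; first by rewrite !fdiffnS /fdiffn /= -!fE; ring.
by rewrite fdiffnS !IHk !fdiffnS -[k.+2]addn1 -[k.+1]addn1 !natrD; ring.
Qed.

(* Stated without division, so that no point [y] has to be excluded from the
   induction. *)
Lemma fdiffn_quotient j y :
  ffact (x - y) j.+1 * fdiffn j g y = j`!%:R * newton_sum j f y (x - y).
Proof.
rewrite /newton_sum; elim: j => [|j IHj].
  by rewrite big_ord1 /ffact big_ord1 big_ord0 /fdiffn /= fact0 -fE; field.
rewrite big_ord_recr /= ffactS fdiffnS_subM factS natrM [RHS]mulrDr.
rewrite -[_ * j`!%:R * \sum_(_ < _) _]mulrA -IHj.
have Sj_neq0 : j.+1%:R != 0 :> R by rewrite pnatr_eq0.
have fact_neq0 := natr_fact_neq0 R j.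
move: (j.+1%:R) (j`!%:R) Sj_neq0 fact_neq0 => s c s_neq0 c_neq0.
by field; rewrite c_neq0 s_neq0.
Qed.

End Quotient.
End FiniteDifferences.

Section BinomialMoments.
Variables (R : realFieldType) (p : R).

Lemma wbin_gt0 N x : 0 < p -> p < 1 -> (x <= N)%N -> 0 < wbin N p x.
Proof.
move=> p_gt0 p_lt1 le_xN.
by rewrite /wbin !mulr_gt0 ?exprn_gt0 ?subr_gt0 // ltr0n bin_gt0.
Qed.

Lemma sum_wbin N : \sum_(x < N.+1) wbin N p x = 1.
Proof.
rewrite -[RHS](expr1n _ N) -[in RHS](subrK p 1) exprDn.
by apply: eq_bigr => x _; rewrite /wbin -mulr_natl; ring.
Qed.

Lemma sum_mul_wbinS N (g : nat -> R) :
  \sum_(x < N.+2) x%:R * g x * wbin N.+1 p x =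
    N.+1%:R * p * \sum_(x < N.+1) g x.+1 * wbin N p x.
Proof.
rewrite big_ord_recl !mul0r add0r mulr_sumr; apply: eq_bigr => x _ /=.
have /(congr1 (fun n => n%:R : R)) := mul_bin_diag N.+1 x.
rewrite !natrM => bin_diag.
rewrite /wbin /bump add1n subSS exprS.
transitivity (x.+1%:R * 'C(N.+1, x.+1)%:R *
  (g x.+1 * p * p ^+ x * (1 - p) ^+ (N - x))); first by ring.
by rewrite -bin_diag; ring.
Qed.

Lemma sum_comul_wbinS N (g : nat -> R) :
  \sum_(x < N.+2) (N.+1 - x)%:R * g x * wbin N.+1 p x =
    N.+1%:R * (1 - p) * \sum_(x < N.+1) g x * wbin N p x.
Proof.
rewrite big_ord_recr /= subnn !mul0r addr0 mulr_sumr; apply: eq_bigr => x _.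
have /(congr1 (fun n => n%:R : R)) := mul_bin_down N.+1 x.
rewrite !natrM => bin_down.
have le_xN : (x <= N)%N by rewrite -ltnS.
rewrite /wbin subSn // exprS; rewrite subSn // in bin_down.
transitivity ((N - x).+1%:R * 'C(N.+1, x)%:R *
  (g x * (1 - p) * p ^+ x * (1 - p) ^+ (N - x))); first by ring.
by rewrite -bin_down; ring.
Qed.

Lemma sum_cofactorial_wbin N m :
  \sum_(x < N.+1) ((N - x) ^_ m)%:R * wbin N p x = (N ^_ m)%:R * (1 - p) ^+ m.
Proof.
elim: m N => [|m IHm] N.
  by under eq_bigr do rewrite mul1r; rewrite sum_wbin mul1r.
case: N => [|N]; first by rewrite big_ord1 sub0n !ffact0n !mul0r.
under eq_bigr do rewrite ffactnS natrM.
rewrite (sum_comul_wbinS N (fun x => ((N.+1 - x).-1 ^_ m)%:R)).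
under eq_bigr do rewrite subSKn.
by rewrite IHm ffactSS natrM exprS; ring.
Qed.

Lemma sum_factorial_cofactorial_wbin N k m :
  \sum_(x < N.+1) (x ^_ k)%:R * ((N - x) ^_ m)%:R * wbin N p x =
    (N ^_ (k + m))%:R * p ^+ k * (1 - p) ^+ m.
Proof.
elim: k N => [|k IHk] N.
  by under eq_bigr do rewrite mul1r; rewrite sum_cofactorial_wbin mulr1.
case: N => [|N]; first by rewrite big_ord1 !ffact0n !mul0r.
under eq_bigr do rewrite ffactnS natrM -(mulrA _%:R).
rewrite (sum_mul_wbinS N (fun x => (x.-1 ^_ k)%:R * ((N.+1 - x) ^_ m)%:R)) /=.
under eq_bigr do rewrite subSS.
by rewrite IHk addSn ffactSS natrM exprS; ring.
Qed.

End BinomialMoments.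

Section Kravchuk.
Variables (R : realFieldType) (N : nat) (p : R).
Implicit Types (n k m j i : nat) (x y : R).

Local Notation node := (fun i : 'I_N.+1 => (i : nat)%:R : R).
Local Notation weight := (fun i : 'I_N.+1 => wbin N p i).
Local Notation wdot := (dotp node weight).

Definition Kpoly n : {poly R} :=
  ((-1) ^+ n * p ^+ n * (N ^_ n)%:R) *:
  \sum_(k < n.+1)
     ((-1) ^+ k * 'C(n, k)%:R / ((N ^_ k)%:R * p ^+ k)) *: ffact_poly R k.

Lemma horner_Kpoly n x : (Kpoly n).[x] = Kraw N p n x.
Proof.
rewrite hornerZ horner_sum /Kraw poch_opp ffact_nat; congr (_ * _); first by ring.
apply: eq_bigr => k _; rewrite hornerZ horner_ffact_poly !poch_opp !ffact_nat.
rewrite -[(n ^_ k)%N]bin_ffact natrM; have fact_neq0 := natr_fact_neq0 R k.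
have sign_neq0 : (-1) ^+ k != 0 :> R by rewrite signr_eq0.
rewrite !invfM; move: ((N ^_ k)%:R^-1) (p ^- k) => u v.
by field; rewrite fact_neq0 sign_neq0.
Qed.

Local Notation wriesz := (riesz node weight Kpoly).

Lemma fdiff_at_Kpoly j n x : fdiff_at j x (Kpoly n) = fdiffn j (Kraw N p n) x.
Proof. exact/eq_fdiffn/horner_Kpoly. Qed.

Lemma knorm2E n : knorm2 N p n = wdot (Kpoly n) (Kpoly n).
Proof. by apply: eq_bigr => x _; rewrite horner_Kpoly expr2. Qed.

Lemma kernE n i l x y :
  kern N p n i l x y = fdiff_at i x (wriesz n (fdiff_at l y)).
Proof.
rewrite scalar_riesz; apply: eq_bigr => k _.
by rewrite knorm2E /= !fdiff_at_Kpoly.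
Qed.

Lemma Kpoly_monic_size n : p != 0 -> (n <= N)%N ->
  Kpoly n \is monic /\ size (Kpoly n) = n.+1.
Proof.
move=> p_neq0 le_nN; rewrite /Kpoly big_ord_recr scalerDr scalerA /= addrC.
set lower := _ *: \sum_(k < n) _.
have size_lower : (size lower < size (ffact_poly R n))%N.
  rewrite size_ffact_poly ltnS (leq_trans (size_scale_leq _ _)) //.
  by apply: size_lincomb_leq => k; rewrite size_ffact_poly.
have -> : (-1) ^+ n * p ^+ n * (N ^_ n)%:R *
    ((-1) ^+ n * 'C(n, n)%:R / ((N ^_ n)%:R * p ^+ n)) = 1.
  rewrite binn -[RHS](sqrr_sign R n); field.
  by rewrite natr_ffact_neq0 ?expf_neq0.
rewrite scale1r monicE lead_coefDl // size_polyDl // size_ffact_poly.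
by split=> //; apply: monic_prod_XsubC.
Qed.

(* Tested against [coffact_poly], whose moments with falling factorials under the
   binomial weight are explicit, the sum defining [Kpoly n] becomes an [n]-th
   difference of a polynomial of degree less than [n]. *)
Lemma Kpoly_orthogonal n (q : {poly R}) : p != 0 -> (n <= N)%N ->
  (size q <= n)%N -> wdot (Kpoly n) q = 0.
Proof.
move=> p_neq0 le_nN.
apply: (scalar_graded_eq0 (g := coffact_poly R N)) => m lt_mn.
  exact: size_coffact_poly.
rewrite /= dotpC scalarZ linear_sum /=.
transitivity ((-1) ^+ n * p ^+ n * (N ^_ n)%:R * (1 - p) ^+ m *
    \sum_(k < n.+1) (-1) ^+ k * 'C(n, k)%:R * (coffact_poly R N m).[k%:R]).
  rewrite -[RHS]mulrA; congr (_ * _); rewrite mulr_sumr; apply: eq_bigr => k _.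
  have le_kN : (k <= N)%N by rewrite (leq_trans _ le_nN) // -ltnS.
  rewrite scalarZ /= horner_coffact_poly //.
  have -> : wdot (coffact_poly R N m) (ffact_poly R k) =
      (N ^_ (k + m))%:R * p ^+ k * (1 - p) ^+ m.
    rewrite -sum_factorial_cofactorial_wbin; apply: eq_bigr => i _.
    rewrite horner_coffact_poly -1?ltnS // horner_ffact_poly ffact_nat.
    by rewrite (mulrC _%:R).
  rewrite ffactnD natrM; field.
  by rewrite natr_ffact_neq0 ?expf_neq0.
by rewrite sum_sign_bin_horner_eq0 ?mulr0 // size_coffact_poly.
Qed.

Hypotheses (p_gt0 : 0 < p) (p_lt1 : p < 1).

Lemma Kpoly_monic_orthogonal : monic_orthogonal node weight N.+1 Kpoly.
Proof.
have p_neq0 := lt0r_neq0 p_gt0; move=> n; rewrite ltnS => le_nN.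
have [monicK sizeK] := Kpoly_monic_size p_neq0 le_nN.
by split=> // q; apply: Kpoly_orthogonal.
Qed.

Let weight_gt0 (i : 'I_N.+1) : 0 < weight i.
Proof. by rewrite wbin_gt0 // -ltnS. Qed.

Let node_inj : injective node.
Proof. by move=> i k /eqP; rewrite eqr_nat => /eqP/val_inj. Qed.

Let card_nodes : (N.+1 <= #|'I_N.+1|)%N.
Proof. by rewrite card_ord. Qed.

Lemma kravchuk_christoffel_darboux n x z : (n < N)%N ->
  (x - z) * (wriesz n.+1 (horner_eval x)).[z] =
    Kraw N p n.+1 x / knorm2 N p n * Kraw N p n z
    + - (Kraw N p n x / knorm2 N p n) * Kraw N p n.+1 z.
Proof.
move=> lt_nN; rewrite knorm2E -opprB mulNr.
have := christoffel_darboux weight_gt0 node_inj card_nodes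
  Kpoly_monic_orthogonal x (lt_nN : (n.+1 < N.+1)%N).
move=> /(congr1 (horner^~ z)); rewrite hornerM hornerXsubC => ->.
by rewrite hornerZ hornerD hornerN !(hornerZ _ (Kpoly _)) !horner_Kpoly; ring.
Qed.

Lemma kern_scrAB n j x y : (0 < n <= N)%N -> ffact (x - y) j.+1 != 0 ->
  kern N p n 0 j x y =
    scrA N p j n x y * Kraw N p n x + scrB N p j n x y * Kraw N p n.-1 x.
Proof.
case: n => // n lt_nN ffact_neq0.
have -> : kern N p n.+1 0 j x y =
    fdiffn j (horner (wriesz n.+1 (horner_eval x))) y.
  by rewrite kernE scalar_rieszC.
have := fdiffn_quotient (fun z => kravchuk_christoffel_darboux x z lt_nN) j y.
rewrite newton_sum_lincomb => /(canRL (mulKf ffact_neq0)) ->.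
by rewrite /scrA /scrB /= -!/(newton_sum _ _ _ _) invfM; ring.
Qed.

Section Sobolev.
Variables (lam mu : R) (j n : nat) (P : {poly R}).
Hypotheses (lam_ge0 : 0 <= lam) (mu_ge0 : 0 <= mu) (le_nN : (n <= N)%N).
Hypotheses (monicP : P \is monic) (sizeP : size P = n.+1).
Hypothesis orthoP : forall q : {poly R},
  (size q <= n)%N -> sobip N p lam mu j P q = 0.

Lemma kravchuk_sobolev_expansion x :
  P.[x] = Kraw N p n x - lam * Phi1 N p lam mu j n * kern N p n 0 j x 0
    - mu * Phi2 N p lam mu j n * kern N p n 0 j x N%:R.
Proof.
have [] := sobolev_functionals weight_gt0 node_inj card_nodes
  Kpoly_monic_orthogonal (L := fdiff_at j 0) (M := fdiff_at j N%:R)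
  lam_ge0 mu_ge0 le_nN monicP sizeP orthoP.
rewrite /= -!kernE !fdiff_at_Kpoly.
rewrite -/(Phi1 N p lam mu j n) -/(Phi2 N p lam mu j n) => L_P M_P.
have -> := sobolev_expansion weight_gt0 node_inj card_nodes
  Kpoly_monic_orthogonal (L := fdiff_at j 0) (M := fdiff_at j N%:R)
  le_nN monicP sizeP orthoP.
by rewrite /= L_P M_P !(hornerD, hornerN) horner_Kpoly !hornerZ !kernE.
Qed.

Lemma kravchuk_sobolev_connection x :
  (0 < n)%N -> ffact (x - 0) j.+1 != 0 -> ffact (x - N%:R) j.+1 != 0 ->
  P.[x] = C1 N p lam mu j n x * Kraw N p n x
    + D1 N p lam mu j n x * Kraw N p n.-1 x.
Proof.
move=> n_gt0 ffact0_neq0 ffactN_neq0.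
by rewrite kravchuk_sobolev_expansion !kern_scrAB ?n_gt0 // /C1 /D1; ring.
Qed.

End Sobolev.
End Kravchuk.

Section Contiguity.
Variable R : realFieldType.
Implicit Types (p x C D f h : R).

Lemma poch_opp_pred n k :
  poch (- n%:R : R) k = (1 - k%:R / n.+1%:R) * poch (- n.+1%:R) k.
Proof.
have Sn_neq0 : n.+1%:R != 0 :> R by rewrite pnatr_eq0.
apply: (mulfI Sn_neq0); apply: oppr_inj.
have := poch_recl (- n.+1%:R : R) k; rewrite pochS.
have -> : - n.+1%:R + 1 = - n%:R :> R by rewrite -natr1; ring.
rewrite -mulNr => <-; move: (n.+1%:R) Sn_neq0 => s s_neq0.
by field.
Qed.

Definition kravchuk_term N p n x k : R :=
  poch (- n%:R) k * poch (- x) k / (poch (- N%:R) k * k`!%:R) * p ^- k.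

Lemma Kraw_pred N p n x :
  Kraw N p n x = p ^+ n * poch (- N%:R) n *
    \sum_(k < n.+2) (1 - k%:R / n.+1%:R) * kravchuk_term N p n.+1 x k.
Proof.
have Sn_neq0 : n.+1%:R != 0 :> R by rewrite pnatr_eq0.
rewrite big_ord_recr /= divff // subrr mul0r addr0; congr (_ * _).
by apply: eq_bigr => k _; rewrite /kravchuk_term poch_opp_pred !mulrA.
Qed.

Lemma Kraw_combination_3F2 N n p x C D f h :
  (0 < n)%N -> D != 0 ->
  f = n%:R * p * (N%:R - n%:R + 1) * C / D - n%:R + 1 ->
  h = - (p * (N%:R - n%:R + 1) * C - D) ->
  (forall i, (i < n)%N -> f - 1 != - i%:R) ->
  C * Kraw N p n x + D * Kraw N p n.-1 x =
  p ^+ n.-1 * poch (- N%:R) n.-1 * h *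
  \sum_(k < n.+1)
     (poch (- n%:R) k * poch (- x) k * poch f k
       / (poch (- N%:R) k * poch (f - 1) k))
     * (p ^- k / k`!%:R).
Proof.
case: n => // n _ D_neq0 fE hE f_neq /=.
have Sn_neq0 : n.+1%:R != 0 :> R by rewrite pnatr_eq0.
have f_hE : f - 1 = - n.+1%:R * h / D by rewrite fE hE; field.
have f_neq0 : f - 1 != 0 by have := f_neq 0%N isT; rewrite oppr0.
have h_neq0 : h != 0.
  by apply: contraNneq f_neq0; rewrite f_hE => ->; rewrite mulr0 mul0r.
have coefE k : (k <= n.+1)%N ->
    h * (poch f k / poch (f - 1) k) = h - k%:R * D / n.+1%:R.
  move=> le_kn; rewrite -[in poch f k](subrK 1 f) poch_ratio //; last first.
    by apply: poch_neq0 => i lt_ik; apply: f_neq; apply: leq_trans lt_ik le_kn.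
  rewrite f_hE; move: (n.+1%:R) Sn_neq0 => s s_neq0.
  by field; rewrite s_neq0 D_neq0 h_neq0.
have KrawE : Kraw N p n.+1 x = p ^+ n.+1 * poch (- N%:R) n.+1 *
    \sum_(k < n.+2) kravchuk_term N p n.+1 x k by [].
rewrite KrawE Kraw_pred pochS exprS !mulr_sumr -big_split.
apply: eq_bigr => k _ /=.
transitivity (p ^+ n * poch (- N%:R) n * (h * (poch f k / poch (f - 1) k))
    * kravchuk_term N p n.+1 x k); last by rewrite /kravchuk_term !invfM; ring.
rewrite coefE -1?ltnS // hE -natr1.
by field; rewrite natr1.
Qed.

End Contiguity.

Theorem mainTheorem3 (R : realFieldType) (N n j : nat) (p lam mu : R)
  (hp0 : 0 < p) (hp1 : p < 1) (hlam : 0 < lam) (hmu : 0 < mu)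
  (hn1 : (1 <= n)%N) (hnN : (n <= N)%N)
  (P : {poly R})
  (hPmon : P \is monic) (hPsize : size P = n.+1)
  (hPorth : forall q : {poly R}, (size q <= n)%N -> sobip N p lam mu j P q = 0)
  (x : R)
  (hdef0 : ffact (x - 0) j.+1 != 0) (hdefN : ffact (x - N%:R) j.+1 != 0)
  (hD : D1 N p lam mu j n x != 0)
  (hf : forall i : nat, (i < n)%N -> fn N p lam mu j n x - 1 != - i%:R) :
  P.[x] =
  p ^+ n.-1 * poch (- N%:R) n.-1 * hn N p lam mu j n x *
  \sum_(k < n.+1)
     (poch (- n%:R) k * poch (- x) k * poch (fn N p lam mu j n x) k
       / (poch (- N%:R) k * poch (fn N p lam mu j n x - 1) k))
     * (p ^- k / k`!%:R).
Proof.
rewrite (kravchuk_sobolev_connection hp0 hp1 (ltW hlam) (ltW hmu) hnN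
  hPmon hPsize hPorth) //.
exact: Kraw_combination_3F2.
Qed.
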